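(* Let $\xi=\{\gamma_1,\ldots,\gamma_r\}\subset\mathbb{Z}\times\mathbb{Z}_{\geq0}$ be a set of monomial exponents of some toric surface with $(0,0)\notin\mathrm{Conv}(\xi)$, and let $L(x,y)=y$. Put $u_0(\xi)=\max\{L(\gamma_i)\mid\gamma_i\in\xi\}$ and $v_0(\xi)=\max\{|c_x(\gamma_i)|\mid\gamma_i\in\xi\}$, where $c_x$ denotes the first coordinate. Then after at most $$2\cdot u_0(\xi)+2^{u_0(\xi)-1}\cdot v_0(\xi)$$ iterations following $L$, the algorithm stops: for every sequence $\xi_0=\xi,\xi_1,\xi_2,\ldots$ obtained by iterating the algorithm following $L$ (with any of the possible choices of $L$ at each step) there is $k\leq 2u_0(\xi)+2^{u_0(\xi)-1}v_0(\xi)$ such that the semigroup $\mathbb{Z}_{\geq0}\xi_k$ is generated by two elements.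
   Context: For a finite set $\xi=\{\gamma_1,\ldots,\gamma_r\}\subset\mathbb{Z}^2$ of distinct elements, $\mathbb{Z}\xi$ is its integer span, $\mathbb{Z}_{\geq0}\xi$ is the additive semigroup of non-negative integer combinations of $\xi$, and $\mathrm{Conv}(\xi)$ is its convex hull in $\mathbb{R}^2$. $\xi$ is a set of monomial exponents of a toric surface if $\mathbb{Z}\xi=\mathbb{Z}^2$. The algorithm is applied to such sets satisfying $(0,0)\notin\mathrm{Conv}(\xi)$. One step. For $i\neq j$ with $\det(\gamma_i\ \gamma_j)\neq0$ put $A_i=\{\gamma_k-\gamma_i\mid k\neq i,j,\ \det(\gamma_k\ \gamma_j)\neq0\}$, $A_j=\{\gamma_k-\gamma_j\mid k\neq i,j,\ \det(\gamma_k\ \gamma_i)\neq0\}$, and $\xi_{i,j}=A_i\cup A_j\cup\{\gamma_i,\gamma_j\}$. Choices of $L$. Let $L\geq0$ on $\xi$. One says that $L$ chooses $\gamma_i,\gamma_j\in\xi$ if $\det(\gamma_i\ \gamma_j)\neq0$, $L(\gamma_i)\leq L(\gamma_k)$ for all $\gamma_k\in\xi$, $L(\gamma_j)\leq L(\gamma_k)$ for all $\gamma_k\in\xi$ with $\det(\gamma_i\ \gamma_k)\neq0$, and $(0,0)\notin\mathrm{Conv}(\xi_{i,j})$. Such a pair always exists but need not be unique. Iterating the algorithm following $L$ from $\xi$ means forming a sequence $\xi_0=\xi,\xi_1,\xi_2,\ldots$ where, for each $k$, $\xi_{k+1}=(\xi_k)_{i,j}$ for some pair $\gamma_i,\gamma_j\in\xi_k$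 chosen by $L$ (for the set $\xi_k$). The algorithm stops when $\mathbb{Z}_{\geq0}\xi_k$ is generated by two elements. *)

(* Defs.v *)
From HB Require Import structures.
From mathcomp Require Import all_boot all_order all_algebra finmap.
From mathcomp Require Import boolp classical_sets reals.

Set Implicit Arguments.
Unset Strict Implicit.
Unset Printing Implicit Defensive.

Import Order.TTheory GRing.Theory Num.Theory.
Local Open Scope fset_scope.
Local Open Scope classical_set_scope.
Local Open Scope ring_scope.

Definition det2 (a b : int * int) : int := a.1 * b.2 - a.2 * b.1.

Definition toric_exponents (xi : {fset int * int}) : Prop :=
  forall v : int * int, inIntSpan (in_tuple (xi : seq (int * int))) v.

(* All combinations with coefficients in nat, the empty one (zero) included. *)
Definition semigroup (xi : {fset int * int}) : set (int * int) :=
  [set v | exists n : int * int -> nat, v = \sum_(g <- xi) g *+ n g].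

Definition two_generated (xi : {fset int * int}) : Prop :=
  exists a b : int * int, semigroup xi = semigroup [fset a; b]%fset.

Definition Conv (R : realType) (xi : {fset int * int}) : set (R * R) :=
  [set p | exists t : int * int -> R,
     [/\ forall g, g \in xi -> 0 <= t g,
         \sum_(g <- xi) t g = 1
       & p = \sum_(g <- xi) t g *: ((g.1)%:~R : R^o, (g.2)%:~R : R^o)]].

(* The set A_i attached to the ordered pair (gi, gj); A_j is [part xi gj gi]. *)
Definition part (xi : {fset int * int}) (gi gj : int * int) :
    {fset int * int} :=
  [fset g - gi | g in [fset g in xi | [&& g != gi, g != gj & det2 g gj != 0]]]%fset.

Definition step (xi : {fset int * int}) (gi gj : int * int) :
    {fset int * int} :=
  (part xi gi gj `|` part xi gj gi `|` [fset gi; gj])%fset.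

Definition chooses (R : realType) (L : int * int -> int)
    (xi : {fset int * int}) (gi gj : int * int) : Prop :=
  [/\ gi \in xi /\ gj \in xi,
      det2 gi gj != 0,
      forall g, g \in xi -> L gi <= L g,
      forall g, g \in xi -> det2 gi g != 0 -> L gj <= L g
    & ~ Conv (step xi gi gj) ((0, 0) : R * R)].

(* Since the algorithm stops at the first two-generated set, nothing is
   required of the sequence from there on; sequences that keep iterating
   forever are runs as well. *)
Definition run (R : realType) (L : int * int -> int) (xi : {fset int * int})
    (xs : nat -> {fset int * int}) : Prop :=
  xs 0%N = xi /\
  forall k, ~ two_generated (xs k) ->
    exists gi gj, chooses R L (xs k) gi gj /\ xs k.+1 = step (xs k) gi gj.

Definition Ly (g : int * int) : int := g.2.

(* The absolute value only turns int into nat: L is nonnegative on xi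
   wherever u0 is used.  If xi spans Z^2 and L = Ly, then u0 L xi >= 1, so its
   predecessor is the usual u0 L xi - 1. *)
Definition u0 (L : int * int -> int) (xi : {fset int * int}) : nat :=
  \max_(g <- xi) `|L g|%N.

Definition v0 (xi : {fset int * int}) : nat := \max_(g <- xi) `|g.1|%N.

(* Main.v *)
(* Call the second coordinate the level, and write u = u0 and v = v0.  A step
   subtracts from every other element one of the two chosen elements, which have
   minimal levels; abscissae at most double and the integer span is preserved.
   - Descent.  As long as there is a spanning subset of levels <= m (m >= 2), one
     step produces one of levels <= m - 1, except when all elements but one lie
     on a line; in that case the run is a subtractive Euclidean algorithm on the
     multiples of a primitive vector and stops in time.  Hence after u steps
     there is an element of level 1, and the level 0 elements, of abscissa at
     most 2^u v, have greatest common divisor 1.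
   - On level 0 the algorithm is then the subtractive Euclidean algorithm, which
     reaches the unit after at most half of 2^u v further steps.
   - From then on the chosen pair is ((s, 0), (a, 1)) with s = 1 or s = -1 fixed.
     The excess s (a y - x) of (x, y) is positive exactly outside the semigroup
     of this pair.  The property "below every element of level > m with positive
     excess there is one, one level lower, of positive excess smaller by at most
     1" holds for m = u and improves by one at each step; for m = 1 it forbids
     positive excess altogether, so u - 1 steps suffice. *)

Require Import Defs.
From mathcomp Require Import all_boot all_order all_algebra finmap.
From mathcomp Require Import boolp classical_sets reals.
From mathcomp Require Import zify ring.

Set Implicit Arguments.
Unset Strict Implicit.
Unset Printing Implicit Defensive.

Import Order.TTheory GRing.Theory Num.Theory.
Local Open Scope ring_scope.

(** * Semigroups and integer spans *)

Lemma semigroup_gen (xi : {fset int * int}) g : g \in xi -> semigroup xi g.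
Proof.
move=> gxi; exists (fun h => (h == g) : nat).
rewrite (big_fsetD1 g) //= eqxx mulr1n.
rewrite big_seq big1 ?addr0 // => h; rewrite !inE => /andP[/negPf-> _].
by rewrite mulr0n.
Qed.

Lemma semigroupD (xi : {fset int * int}) v w :
  semigroup xi v -> semigroup xi w -> semigroup xi (v + w).
Proof.
move=> [m ->] [n ->]; exists (fun g => m g + n g)%N.
by rewrite -big_split; apply: eq_bigr => g _; rewrite mulrnDr.
Qed.

Lemma semigroup0 (xi : {fset int * int}) : semigroup xi 0.
Proof. by exists (fun=> 0%N); rewrite big1 // => g _; rewrite mulr0n. Qed.

Lemma semigroupMn (xi : {fset int * int}) v n :
  semigroup xi v -> semigroup xi (v *+ n).
Proof.
move=> xiv; elim: n => [|n IHn]; first by rewrite mulr0n; exact: semigroup0.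
by rewrite mulrS; exact: semigroupD.
Qed.

Lemma semigroup_sub (xi eta : {fset int * int}) :
  (forall g : int * int, g \in xi -> semigroup eta g) ->
  forall v, semigroup xi v -> semigroup eta v.
Proof.
move=> sub _ [n ->]; rewrite big_seq; elim/big_ind: _.
- exact: semigroup0.
- by move=> v w; exact: semigroupD.
- by move=> g /sub; exact: semigroupMn.
Qed.

Lemma two_generated_pair (xi : {fset int * int}) a b :
  a \in xi -> b \in xi ->
  (forall g : int * int, g \in xi -> exists m n : nat, g = a *+ m + b *+ n) ->
  two_generated xi.
Proof.
move=> axi bxi gen; exists a, b; apply/seteqP; split; apply: semigroup_sub.
  move=> g /gen[m [n ->]].
  by apply: semigroupD; apply: semigroupMn; apply: semigroup_gen;
    rewrite !inE eqxx ?orbT.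
by move=> g; rewrite !inE => /orP[] /eqP ->; apply: semigroup_gen.
Qed.

(** * Subgroups and spanning sets of the lattice *)

Definition subgroup (H : int * int -> Prop) :=
  H 0 /\ forall x y, H x -> H y -> H (x - y).

(** Phrased through all subgroups, so that a new set is seen to span once each old generator is
    rebuilt from it by sums and differences. *)
Definition spans (P : int * int -> Prop) :=
  forall H, subgroup H -> (forall g, P g -> H g) -> forall v, H v.

Lemma subgroupB H x y : subgroup H -> H x -> H y -> H (x - y).
Proof. by case=> _; apply. Qed.

Lemma subgroupN H x : subgroup H -> H x -> H (- x).
Proof. by case=> H0 HB Hx; rewrite -sub0r; exact: HB. Qed.

Lemma subgroupD H x y : subgroup H -> H x -> H y -> H (x + y).
Proof. by move=> sH Hx Hy; rewrite -[y]opprK; apply: subgroupB => //; exact: subgroupN. Qed.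

Lemma subgroupBK H x y : subgroup H -> H (x - y) -> H y -> H x.
Proof. by move=> sH Hxy Hy; rewrite -(subrK y x); exact: subgroupD. Qed.

Lemma subgroupMz H x n : subgroup H -> H x -> H (x *~ n).
Proof.
move=> sH Hx; have nat_case k : H (x *+ k).
  elim: k => [|k IHk]; first by rewrite mulr0n; case: sH.
  by rewrite mulrS; exact: subgroupD.
by case: n => k; [exact: nat_case | apply: subgroupN => //; exact: nat_case].
Qed.

Lemma toric_spans (xi : {fset int * int}) :
  toric_exponents xi -> spans (fun g : int * int => g \in xi).
Proof.
move=> tor H sH xiH v; have [a ->] := tor v.
elim/big_ind: _ => [||i _]; first by case: sH.
  by move=> x y; exact: subgroupD.
by apply: subgroupMz => //; apply: xiH; rewrite mem_nth.
Qed.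

(** The vectors where the form [a x + b y] is a multiple of [d] form a subgroup. For [d = 0]: a form
    vanishing on a spanning set is zero. *)
Lemma spans_dvd (P : int * int -> Prop) (a b d : int) : spans P ->
  (forall g, P g -> (d %| a * g.1 + b * g.2)%Z) -> (d %| a)%Z /\ (d %| b)%Z.
Proof.
move=> spP Pd.
have dvd v : (d %| a * v.1 + b * v.2)%Z.
  apply: spP Pd v; split=> [|x y dx dy] /=; first by rewrite !mulr0 dvdz0.
  rewrite (_ : _ + _ = (a * x.1 + b * x.2) - (a * y.1 + b * y.2)) /=; last by ring.
  exact: rpredB.
by have := (dvd (1, 0), dvd (0, 1)); rewrite /= !mulr0 !mulr1 addr0 add0r => -[].
Qed.

Lemma spans_trans (P Q : int * int -> Prop) : spans P ->
  (forall H, subgroup H -> (forall g, Q g -> H g) -> forall g, P g -> H g) ->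
  spans Q.
Proof. by move=> spP PQ H sH HQ; apply: spP => //; exact: PQ. Qed.

(** * One step of the algorithm *)

Lemma in_part (xi : {fset int * int}) gi gj h :
  (h - gi \in part xi gi gj) = [&& h \in xi, h != gi, h != gj & det2 h gj != 0].
Proof.
apply/imfsetP/idP => [[g /= + /addIr ->]|hP]; first by rewrite !inE.
by exists h; rewrite //= !inE.
Qed.

Section Step.
Variables (xi : {fset int * int}) (gi gj : int * int).
Implicit Types g h : int * int.

Lemma mem_step_l : gi \in step xi gi gj.
Proof. by rewrite !inE eqxx /= orbT. Qed.

Lemma mem_step_r : gj \in step xi gi gj.
Proof. by rewrite !inE eqxx /= !orbT. Qed.

Lemma mem_step_subl h : h \in xi -> h != gi -> h != gj -> det2 h gj != 0 ->
  h - gi \in step xi gi gj.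
Proof.
move=> hxi hi hj hd; rewrite in_fsetU in_fsetU in_part.
by apply/orP; left; apply/orP; left; apply/and4P.
Qed.

Lemma mem_step_subr h : h \in xi -> h != gi -> h != gj -> det2 h gi != 0 ->
  h - gj \in step xi gi gj.
Proof.
move=> hxi hi hj hd; rewrite in_fsetU in_fsetU [X in _ || X || _]in_part.
by apply/orP; left; apply/orP; right; apply/and4P.
Qed.

Lemma step_ind (Q : int * int -> Prop) : Q gi -> Q gj ->
  (forall h : int * int, h \in xi -> h != gi -> h != gj -> det2 h gj != 0 -> Q (h - gi)) ->
  (forall h : int * int, h \in xi -> h != gi -> h != gj -> det2 h gi != 0 -> Q (h - gj)) ->
  forall g : int * int, g \in step xi gi gj -> Q g.
Proof.
move=> Qi Qj Ql Qr g; rewrite in_fsetU in_fsetU => /orP[/orP[]|].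
- by move=> /imfsetP[h /=]; rewrite !inE => /and4P[? ? ? ?] ->; exact: Ql.
- by move=> /imfsetP[h /=]; rewrite !inE => /and4P[? ? ? ?] ->; exact: Qr.
- by rewrite !inE => /orP[] /eqP ->.
Qed.

End Step.

(** * Levels, and the origin outside the convex hull *)

Definition upper (xi : {fset int * int}) := forall g : int * int, g \in xi -> 0 <= g.2.

(** The trace of the convex hull condition on level 0: nonzero elements (case [g = h]), all on one
    side of the origin. *)
Definition axis_pointed (xi : {fset int * int}) :=
  forall g h : int * int, g \in xi -> h \in xi -> g.2 = 0 -> h.2 = 0 -> 0 < g.1 * h.1.

Lemma abs_cross (x y : int) : x * y <= 0 -> `|y| * x + `|x| * y = 0.
Proof. nia. Qed.

Lemma Conv_axis_pointed (R : realType) (xi : {fset int * int}) :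
  ~ Conv xi ((0, 0) : R * R) -> axis_pointed xi.
Proof.
move=> n0 g h gxi hxi g2 h2; apply: contrapT => /negP; rewrite -leNgt => gh.
apply: n0; have [g1|g1] := eqVneq g.1 0.
  exists (fun k => (k == g)%:R); split=> [k _||].
  - by rewrite ler0n.
  - rewrite (big_fsetD1 g) //= eqxx big_seq big1 ?addr0 // => k.
    by rewrite !inE => /andP[/negPf-> _].
  - rewrite (big_fsetD1 g) //= eqxx big_seq big1 ?addr0 => [|k].
      by rewrite g1 g2 scale1r.
    by rewrite !inE => /andP[/negPf-> _]; rewrite scale0r.
have gNh : h != g.
  by apply: contraTneq gh => ->; rewrite -ltNge -expr2 lt_def sqrf_eq0 g1 sqr_ge0.
have s0 : 0 < (`|g.1| + `|h.1|)%:~R :> R by rewrite ltr0z; lia.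
(* Each of [g], [h] is weighted by the distance of the other from the origin, which puts the
   barycentre at the origin. *)
pose t k : R := (if k == g then `|h.1|%:~R else if k == h then `|g.1|%:~R else 0)
   / (`|g.1| + `|h.1|)%:~R.
have tsum (V : lmodType R) (F : int * int -> V) :
    \sum_(k <- xi) t k *: F k = t g *: F g + t h *: F h.
  rewrite (big_fsetD1 g) //= (big_fsetD1 h) /= ?inE ?gNh // big_seq big1 ?addr0 //.
  move=> k; rewrite !inE => /and3P[kh kg _].
  by rewrite /t (negPf kh) (negPf kg) mul0r scale0r.
exists t; split=> [k _||].
- rewrite /t; apply: divr_ge0; last exact: ltW.
  by do 2?case: ifP => // _; rewrite ler0z.
- transitivity (\sum_(k <- xi) t k *: (1 : R^o)).
    by apply: eq_bigr => k _; rewrite /GRing.scale /= mulr1.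
  rewrite tsum /t eqxx (negPf gNh) eqxx /GRing.scale /= !mulr1 -mulrDl addrC.
  by rewrite -rmorphD divff // lt0r_neq0.
- have comb (x y : int) : `|h.1| * x + `|g.1| * y = 0 ->
      0 = t g * x%:~R + t h * y%:~R.
    rewrite /t eqxx (negPf gNh) eqxx; set e : R := _^-1 => xy.
    transitivity (e * (`|h.1| * x + `|g.1| * y)%:~R); first by rewrite xy mulr0.
    by rewrite rmorphD !rmorphM /= mulrDr !mulrA ![e * _]mulrC.
  rewrite tsum; congr (_, _); apply: comb; first exact: abs_cross.
  by rewrite g2 h2 !mulr0 addr0.
Qed.

Lemma det2C g h : det2 g h = - det2 h g.
Proof. by rewrite /det2; ring. Qed.

Lemma det2_eq0 g a b : det2 a b != 0 -> det2 g a = 0 -> det2 g b = 0 -> g = 0.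
Proof.
move=> ab ga gb.
have g1 : g.1 * det2 a b = b.1 * - det2 g a + a.1 * det2 g b.
  by rewrite /det2; ring.
have g2 : g.2 * det2 a b = b.2 * - det2 g a + a.2 * det2 g b.
  by rewrite /det2; ring.
move: g1 g2; rewrite ga gb oppr0 !mulr0 addr0 => /eqP + /eqP.
rewrite !mulf_eq0 (negPf ab) !orbF => /eqP g1 /eqP g2.
by rewrite [g]surjective_pairing g1 g2.
Qed.

Definition good_pair (xi : {fset int * int}) (gi gj : int * int) :=
  [/\ gi \in xi /\ gj \in xi,
      det2 gi gj != 0,
      forall g : int * int, g \in xi -> gi.2 <= g.2,
      forall g : int * int, g \in xi -> det2 gi g != 0 -> gj.2 <= g.2
    & axis_pointed (step xi gi gj)].

(** The second clause makes 1 the gcd of the level 0 abscissae; with [d = 0] it also says that level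
    0 is occupied. *)
Definition reaches_one (xi : {fset int * int}) :=
  (exists2 g : int * int, g \in xi & g.2 = 1) /\
  forall d : int, (forall g : int * int, g \in xi -> g.2 = 0 -> (d %| g.1)%Z) -> (d %| 1)%Z.

Lemma int_pair_eq (g h : int * int) : g.1 = h.1 -> g.2 = h.2 -> g = h.
Proof. by move: g h => [? ?] [? ?] /= -> ->. Qed.

Lemma axis_pointed_neq0 xi (g : int * int) : axis_pointed xi -> g \in xi -> g != 0.
Proof. by move=> px gxi; apply: contraPneq (px g g gxi gxi) => -> /(_ erefl erefl). Qed.

Section GoodStep.
Variables (xi : {fset int * int}) (gi gj : int * int).
Implicit Types g h : int * int.
Hypotheses (good : good_pair xi gi gj) (up : upper xi) (pointed : axis_pointed xi).

Let gixi : gi \in xi. Proof. by case: good => -[]. Qed.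
Let gjxi : gj \in xi. Proof. by case: good => -[]. Qed.
Let ij : det2 gi gj != 0. Proof. by case: good. Qed.
Let mini (g : int * int) : g \in xi -> gi.2 <= g.2. Proof. by case: good => _ _ + _ _; apply. Qed.
Let minj (g : int * int) : g \in xi -> det2 g gi != 0 -> gj.2 <= g.2.
Proof. by case: good => _ _ _ minj _ gxi gd; apply: minj => //; rewrite det2C oppr_eq0. Qed.
Let pointed' : axis_pointed (step xi gi gj). Proof. by case: good. Qed.

Lemma step_upper : upper (step xi gi gj).
Proof.
apply: step_ind => [||h hxi _ _ _|h hxi _ _ hd] /=; try exact: up.
  by have := mini hxi; lia.
by have := minj hxi hd; lia.
Qed.

Lemma step_level_le m : (forall g : int * int, g \in xi -> g.2 <= m) ->
  forall g : int * int, g \in step xi gi gj -> g.2 <= m.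
Proof.
move=> le_m; have := (up gixi, up gjxi) => -[i0 j0].
by apply: step_ind => [||h /le_m + _ _ _|h /le_m + _ _ _] /=; [exact: le_m|exact: le_m|lia|lia].
Qed.

Lemma step_abscissa_le (X : int) : (forall g : int * int, g \in xi -> `|g.1| <= X) ->
  forall g : int * int, g \in step xi gi gj -> `|g.1| <= 2 * X.
Proof.
move=> leX; have := (leX _ gixi, leX _ gjxi) => -[? ?].
by apply: step_ind => [||h /leX + _ _ _|h /leX + _ _ _] /=; lia.
Qed.

Lemma step_det2_neq0 h : h \in xi -> (det2 h gi != 0) || (det2 h gj != 0).
Proof.
move=> hxi; rewrite -negb_and; apply: contraTN hxi => /andP[/eqP hi /eqP hj].
by apply/negP => /(axis_pointed_neq0 pointed); rewrite (det2_eq0 ij hi hj) eqxx.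
Qed.

(** Every unchosen element is nonzero, hence independent of [gi] or of [gj], so at least one shifted
    copy of it survives. *)
Lemma step_spans : spans (fun g : int * int => g \in xi) -> spans (fun g : int * int => g \in step xi gi gj).
Proof.
move=> /spans_trans; apply=> H sH stepH h hxi.
have [Hi Hj] := (stepH _ (mem_step_l xi gi gj), stepH _ (mem_step_r xi gi gj)).
have [->//|hi] := eqVneq h gi; have [->//|hj] := eqVneq h gj.
case/orP: (step_det2_neq0 hxi) => hd.
  by apply: (@subgroupBK _ _ gj) => //; apply: stepH; exact: mem_step_subr.
by apply: (@subgroupBK _ _ gi) => //; apply: stepH; exact: mem_step_subl.
Qed.

(** * Steps when level 0 is occupied *)

Section Axis.
Variable g0 : int * int.
Hypotheses (g0xi : g0 \in xi) (g0axis : g0.2 = 0).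

Lemma axis_gi : gi.2 = 0.
Proof. by have := mini g0xi; have := up gixi; lia. Qed.

Lemma axis_gi_neq0 : gi.1 != 0.
Proof. by apply: contraNneq ij => i1; rewrite /det2 axis_gi i1; apply/eqP; ring. Qed.

Lemma axis_gj_gt0 : 0 < gj.2.
Proof.
rewrite lt_def up // andbT; apply: contraNneq ij => j2.
by rewrite /det2 axis_gi j2; apply/eqP; ring.
Qed.

Lemma axis_det2 h : (det2 h gi != 0) = (h.2 != 0).
Proof.
rewrite /det2 axis_gi mulr0 sub0r oppr_eq0 mulf_eq0 (negPf axis_gi_neq0) orbF.
by [].
Qed.

Lemma axis_gj_min g : g \in xi -> 0 < g.2 -> gj.2 <= g.2.
Proof. by move=> gxi g2; apply: minj => //; rewrite axis_det2; lia. Qed.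

Lemma axis_step_off h : h \in xi -> h != gj -> 0 < h.2 ->
  h - gj \in step xi gi gj.
Proof.
move=> hxi hj h2; apply: mem_step_subr => //; last by rewrite axis_det2; lia.
by apply: contraTneq h2 => ->; rewrite axis_gi.
Qed.

Lemma axis_step_on h : h \in xi -> h != gi -> h.2 = 0 -> h - gi \in step xi gi gj.
Proof.
move=> hxi hi h2; have h1 : h.1 != 0.
  by have := pointed hxi hxi h2 h2; apply: contraTneq => ->; rewrite mulr0.
apply: mem_step_subl => //.
  by apply: contra_eqN h2 => /eqP ->; have := axis_gj_gt0; lia.
by rewrite /det2 h2 mul0r subr0 mulf_neq0 //; have := axis_gj_gt0; lia.
Qed.

(** Here [gj] has the least positive level. Were it at least [m], all levels up to [m] would be
    multiples of [m], against spanning. So [gj] lies below [m], and any other [h] of positive level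
    is rebuilt from [gj] and the lower [h - gj]. *)
Lemma axis_step_drop m : 1 < m -> spans (fun g : int * int => g \in xi /\ g.2 <= m) ->
  spans (fun g : int * int => g \in step xi gi gj /\ g.2 <= m - 1).
Proof.
move=> m1 spm; have j0 := axis_gj_gt0.
have jm : gj.2 < m.
  rewrite ltNge; apply/negP => mj.
  have [|_] := @spans_dvd _ 0 1 m spm; last by rewrite dvdz1; lia.
  move=> g [gxi gm]; rewrite mul0r add0r mul1r.
  have [g2|/eqP g2] := eqVneq g.2 0; first by rewrite g2 dvdz0.
  suff -> : g.2 = m by [].
  by have := up gxi; have := @axis_gj_min g gxi; lia.
apply: spans_trans spm _ => H sH stepH h [hxi hm].
have Hi : H gi by apply: stepH; rewrite mem_step_l axis_gi; split=> //; lia.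
have Hj : H gj by apply: stepH; rewrite mem_step_r; split=> //; lia.
have [->//|hi] := eqVneq h gi; have [->//|hj] := eqVneq h gj.
have [h2|/eqP h2] := eqVneq h.2 0.
  apply: (@subgroupBK _ _ gi) => //; apply: stepH.
  by split; [exact: axis_step_on | rewrite /= h2 axis_gi; lia].
apply: (@subgroupBK _ _ gj) => //; apply: stepH; have := up hxi => h0.
by split; [apply: axis_step_off => //; lia | rewrite /=; lia].
Qed.

Lemma axis_step_last : spans (fun g : int * int => g \in xi /\ g.2 <= 1) ->
  reaches_one (step xi gi gj).
Proof.
move=> sp1; have j0 := axis_gj_gt0.
have j1 : gj.2 = 1.
  apply: contrapT => j1.
  have [|_] := @spans_dvd _ 0 1 0 sp1; last by [].
  move=> g [gxi g1]; rewrite mul0r add0r mul1r dvd0z.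
  by have := up gxi; have := @axis_gj_min g gxi; lia.
split; first by exists gj; rewrite ?mem_step_r.
(* The form [x - gj.1 * y] is 0 at [gj]; at the other elements of level 0 or 1 it is a sum of level
   0 abscissae of the step. So [d] divides its coefficient 1. *)
move=> d dvd; suff [] : (d %| 1)%Z /\ (d %| - gj.1)%Z by [].
apply: (spans_dvd sp1) => h [hxi h1]; rewrite mul1r.
have di : (d %| gi.1)%Z by apply: dvd; [exact: mem_step_l | exact: axis_gi].
have [h2|/eqP h2] := eqVneq h.2 0.
  rewrite h2 mulr0 addr0; have [->//|hi] := eqVneq h gi.
  rewrite -(subrK gi.1 h.1); apply: rpredD => //.
  by apply: (dvd (h - gi)); [exact: axis_step_on | rewrite /= h2 axis_gi].
have {}h2 : h.2 = 1 by have := up hxi; lia.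
rewrite h2 mulr1; have [->|hj] := eqVneq h gj; first by rewrite subrr dvdz0.
by apply: (dvd (h - gj)); [apply: axis_step_off; rewrite ?h2 | rewrite /= h2 j1].
Qed.

End Axis.

(** * Steps when all levels are positive *)

Section OffAxis.
Variable m : int.
Hypotheses (pos : forall g : int * int, g \in xi -> 0 < g.2) (le_m : forall g : int * int, g \in xi -> g.2 <= m).

Lemma off_axis_step_drop : gj.2 < m -> forall g : int * int, g \in step xi gi gj -> g.2 <= m - 1.
Proof.
move=> jm; have := (pos gixi, pos gjxi, mini gjxi) => -[[? ?] ?].
by apply: step_ind => [||h /le_m + _ _ _|h /le_m + _ _ _] /=; lia.
Qed.

Section Top.
Variable w : int * int.
Hypotheses (jm : gj.2 = m) (wxi : w \in xi) (wj : w != gj) (wd : det2 w gi != 0).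

Let w2 : w.2 = m. Proof. by have := minj wxi wd; have := le_m wxi; lia. Qed.
Let wi : w != gi.
Proof. by apply: contraNneq wd => ->; rewrite /det2; apply/eqP; ring. Qed.

(** If [h] were parallel to [gj], it would be independent of [gi], hence of level [m] by the choice
    of [gj]; parallel vectors of equal nonzero level coincide. *)
Lemma top_sub_gi h : h \in xi -> h != gi -> h != gj -> h - gi \in step xi gi gj.
Proof.
move=> hxi hi hj; apply: mem_step_subl => //; apply/eqP => hd.
have := step_det2_neq0 hxi; rewrite hd eqxx orbF => /(minj hxi) jh.
have h2 : h.2 = m by have := le_m hxi; lia.
have m0 : m != 0 by have := pos hxi; lia.
case/eqP: hj; apply: int_pair_eq; last by rewrite h2.
by apply: (mulIf m0); move: hd; rewrite /det2 jm h2; lia.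
Qed.

Lemma top_sub_gj : w - gj \in step xi gi gj.
Proof. exact: mem_step_subr. Qed.

Lemma top_axis : (w - gj).2 = 0.
Proof. by rewrite /= w2 jm subrr. Qed.

Let gjE : gj = (w - gi) - (w - gj) + gi.
Proof. by apply: int_pair_eq => /=; ring. Qed.

(* [gj] is the only element of the step that may sit at the top level, and it
   is spanned by [gi], [w - gi] and [w - gj]. *)
Lemma top_step_drop : 1 < m -> spans (fun g : int * int => g \in xi) ->
  spans (fun g : int * int => g \in step xi gi gj /\ g.2 <= m - 1).
Proof.
move=> m1 sp; have im : gi.2 < m.
  rewrite ltNge; apply/negP => mi.
  have [|_] := @spans_dvd _ 0 1 m sp; last by rewrite dvdz1; lia.
  move=> g gxi; rewrite mul0r add0r mul1r; suff -> : g.2 = m by [].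
  by have := mini gxi; have := le_m gxi; lia.
have i0 := pos gixi.
apply: spans_trans sp _ => H sH stepH.
have Hi : H gi by apply: stepH; rewrite mem_step_l; split=> //; lia.
have sub h : h \in xi -> h != gi -> h != gj -> H (h - gi).
  move=> hxi hi hj; apply: stepH; split; first exact: top_sub_gi.
  by have := le_m hxi; rewrite /=; lia.
have Hj : H gj.
  rewrite gjE; apply: subgroupD => //; apply: subgroupB => //; first exact: sub.
  by apply: stepH; rewrite top_axis; split; [exact: top_sub_gj | lia].
move=> h hxi; have [->//|hi] := eqVneq h gi; have [->//|hj] := eqVneq h gj.
by apply: (@subgroupBK _ _ gi) => //; exact: sub.
Qed.

(** All levels are 1, so [x - gi.1 * y] at [h] is the abscissa of the level 0 vector [h - gi]. As
    [gj] itself is not shifted, its value is recovered from [w - gi] and [w - gj]. *)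
Lemma top_step_last : m = 1 -> spans (fun g : int * int => g \in xi) ->
  reaches_one (step xi gi gj).
Proof.
move=> m1 sp; have lev h : h \in xi -> h.2 = 1.
  by move=> hxi; have := pos hxi; have := le_m hxi; lia.
split; first by exists gj; rewrite ?mem_step_r ?lev.
move=> d dvd; suff [] : (d %| 1)%Z /\ (d %| - gi.1)%Z by [].
have sub h : h \in xi -> h != gi -> h != gj -> (d %| h.1 - gi.1)%Z.
  move=> hxi hi hj; apply: (dvd (h - gi)); first exact: top_sub_gi.
  by rewrite /= !lev.
apply: (spans_dvd sp) => h hxi; rewrite mul1r lev // mulr1.
have [->|hi] := eqVneq h gi; first by rewrite subrr dvdz0.
have [->|hj] := eqVneq h gj; last exact: sub.
rewrite (_ : _ - _ = (w.1 - gi.1) - (w.1 - gj.1)); last by ring.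
apply: rpredB; first exact: sub.
by apply: (dvd (w - gj)); [exact: top_sub_gj | exact: top_axis].
Qed.

End Top.
End OffAxis.
End GoodStep.

(** * Subtractive Euclid on a line and on the axis *)

(** [N t n] means that [n] is present at time [t], and [p] is the subtracted minimum. Unless 1 is
    present now or one step later, [p] is at least 2, so the bound up to which the values have gcd 1
    drops by 2 per step. *)
Lemma subtractive_euclid (N : nat -> nat -> Prop) (M s : nat) :
  (forall t, (s <= t < s + M./2)%N -> exists p, [/\ (0 < p)%N, N t p, N t.+1 p
     & forall n, N t n -> n = p \/ (p < n)%N /\ N t.+1 (n - p)%N]) ->
  (forall d, (forall n, N s n -> (n <= M)%N -> (d %| n)%N) -> d = 1%N) ->
  exists2 k, (k <= M./2)%N & N (s + k)%N 1%N.
Proof.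
elim/ltn_ind: M s => M IHM s HN gcd1.
have [s1|s1] := pselect (N s 1%N); first by exists 0%N; rewrite ?addn0.
have M2 : (1 < M)%N.
  rewrite ltnNge; apply/negP => M1; suff : 2%N = 1%N by []; apply: gcd1 => n Nn nM.
  have [->//|n1] : n = 0%N \/ n = 1%N by lia.
  by rewrite n1 in Nn.
have M2half : M./2 = ((M - 2)./2).+1 by lia.
have [p [p0 Np N'p sub]] := HN s ltac:(lia).
have p1 : p <> 1%N by move=> p1; rewrite p1 in Np.
have [N'1|N'1] := pselect (N s.+1 1%N).
  by exists 1%N; [lia | rewrite addn1].
(* Otherwise a value up to [M] other than [p] could only be [p + 1], which would leave 1 at the next
   time; so [p] would be the gcd. *)
have pM : (p <= M - 2)%N.
  rewrite leqNgt; apply/negP => Mp; apply: p1; apply: gcd1 => n Nn nM.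
  case: (sub n Nn) => [->//|[pn N'n]]; case: N'1.
  by move: N'n; rewrite (_ : (n - p)%N = 1%N) //; lia.
have [t ?|d dvd|k ? Nk] := IHM (M - 2)%N ltac:(lia) s.+1.
- by apply: HN; lia.
- apply: gcd1 => n Nn nM; have dp : (d %| p)%N by exact: dvd.
  case: (sub n Nn) => [->//|[pn N'n]].
  by rewrite -(subnK (ltnW pn)) dvdn_add //; apply: dvd => //; lia.
- by exists k.+1; [lia | rewrite addnS -addSn].
Qed.

Lemma step_swap xi gi gj : step xi gi gj = step xi gj gi.
Proof.
by rewrite /step [(part xi gi gj `|` _)%fset]fsetUC [[fset gi; gj]%fset]fsetUC.
Qed.

Lemma pairMn_fst (g : int * int) n : (g *+ n).1 = g.1 * n%:Z.
Proof. by elim: n => [|n IHn]; rewrite ?mulr0n ?mulr0 // mulrS /= IHn; lia. Qed.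

Lemma pairMn_snd (g : int * int) n : (g *+ n).2 = g.2 * n%:Z.
Proof. by elim: n => [|n IHn]; rewrite ?mulr0n ?mulr0 // mulrS /= IHn; lia. Qed.

Lemma det2Mn g h n : det2 (g *+ n) h = det2 g h * n%:Z.
Proof. by rewrite /det2 pairMn_fst pairMn_snd; ring. Qed.

Lemma det2Mnr g h n : det2 h (g *+ n) = det2 h g * n%:Z.
Proof. by rewrite /det2 pairMn_fst pairMn_snd; ring. Qed.

(** * Sets with all elements but one on a line *)

Section Line.
Variables (w h : int * int).
Hypotheses (wh : det2 w h != 0) (w2 : 0 < w.2).
Implicit Types xi : {fset int * int}.

Definition on_line xi :=
  h \in xi /\
  forall g : int * int, g \in xi -> g = h \/ exists2 n, (0 < n)%N & g = w *+ n.

Let lineNh n : (0 < n)%N -> w *+ n != h.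
Proof.
move=> n0; apply: contraNneq wh => <-.
by rewrite det2Mnr (_ : det2 w w = 0) ?mul0r //; rewrite /det2; ring.
Qed.

(** Multiples of [w] are parallel to [w *+ p], so none is shifted by [h]: the step is one round of
    subtractive Euclid on the multipliers. *)
Lemma on_line_step_min xi p : on_line xi -> (0 < p)%N -> w *+ p \in xi ->
  (forall n, (0 < n)%N -> w *+ n \in xi -> (p <= n)%N) ->
  on_line (step xi (w *+ p) h) /\
  (forall n, (0 < n)%N -> w *+ n \in xi ->
     n = p \/ (p < n)%N /\ w *+ (n - p)%N \in step xi (w *+ p) h).
Proof.
move=> [hxi line] p0 pxi minp; split; first split; first exact: mem_step_r.
- apply: step_ind => [||g gxi gp gh _|g gxi gp gh gd]; first by right; exists p.
  + by left.
  + right; case: (line g gxi) => [/eqP|[n n0 gE]]; first by rewrite (negPf gh).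
    have pn : (p < n)%N.
      rewrite ltn_neqAle minp -?gE // andbT.
      by apply: contraNneq gp => ->; rewrite gE.
    exists (n - p)%N; first by lia.
    by rewrite gE (mulrnBr w (ltnW pn)).
  + case: (line g gxi) => [/eqP|[n n0 gE]]; first by rewrite (negPf gh).
    case/eqP: gd; rewrite gE det2Mn det2Mnr.
    by rewrite (_ : det2 w w = 0) ?mul0r //; rewrite /det2; ring.
- move=> n n0 nxi; have [->|np] := eqVneq n p; [by left | right].
  have pn : (p < n)%N by rewrite ltn_neqAle eq_sym np minp.
  split; first exact: pn.
  rewrite (mulrnBr w (ltnW pn)); apply: mem_step_subl; first exact: nxi.
  + apply: contraNneq np => npE; have := congr1 snd npE.
    rewrite !pairMn_snd => /(mulfI (lt0r_neq0 w2)); lia.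
  + exact: lineNh.
  + by rewrite det2Mn mulf_neq0 //; lia.
Qed.

(** Two multiples of [w] are dependent, so [h] is in the chosen pair, in either position; the least
    level gives the least multiplier. *)
Lemma on_line_step xi gi gj : good_pair xi gi gj -> on_line xi ->
  on_line (step xi gi gj) /\
  exists p, [/\ (0 < p)%N, w *+ p \in xi, w *+ p \in step xi gi gj
    & forall n, (0 < n)%N -> w *+ n \in xi ->
        n = p \/ (p < n)%N /\ w *+ (n - p)%N \in step xi gi gj].
Proof.
case=> -[gixi gjxi] ij mini minj _ line.
have ww : det2 w w = 0 by rewrite /det2; ring.
have [Eh|[p p0 Ep]] := line.2 gi gixi.
  have [Eh'|[p p0 Ep]] := line.2 gj gjxi.
    by case/eqP: ij; rewrite Eh Eh' /det2; ring.
  rewrite step_swap Eh; have [||||l' sub] := @on_line_step_min xi p => //.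
  - by rewrite -Ep.
  - move=> n n0 nxi; have := minj _ nxi; rewrite Ep Eh !pairMn_snd ler_pM2l //.
    by rewrite lez_nat; apply; rewrite det2C oppr_eq0 det2Mn mulf_neq0 //; lia.
  - rewrite Ep; split=> //; exists p; split=> //; first by rewrite -Ep.
    exact: mem_step_l.
have [Eh'|[q q0 Eq]] := line.2 gj gjxi; last first.
  by case/eqP: ij; rewrite Ep Eq det2Mn det2Mnr ww mul0r.
rewrite Ep Eh'; have [||||l' sub] := @on_line_step_min xi p => //.
- by rewrite -Ep.
- by move=> n n0 nxi; have := mini _ nxi; rewrite Ep !pairMn_snd ler_pM2l // lez_nat.
- split=> //; exists p; split=> //; first by rewrite -Ep.
  exact: mem_step_l.
Qed.

Lemma on_line_two_generated xi : on_line xi -> w \in xi -> two_generated xi.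
Proof.
move=> [hxi line] wxi; apply: (two_generated_pair wxi hxi) => g /line[->|[n _ ->]].
  by exists 0%N, 1%N; rewrite mulr0n add0r.
by exists n, 0%N; rewrite mulr0n addr0.
Qed.

End Line.

(* If [gj] alone sits off the line spanned by [gi], then [det2 gi gj] divides
   [det2 gi] of every vector, so [gi / det2 gi gj] is an integral generator of
   that line. *)
Lemma line_generator xi gi gj : det2 gi gj != 0 -> gi \in xi -> gj \in xi ->
  (forall g : int * int, g \in xi -> 0 < g.2) -> spans (fun g : int * int => g \in xi) ->
  (forall g : int * int, g \in xi -> g != gj -> det2 g gi = 0) ->
  exists w, [/\ `|det2 w gj| = 1, 0 < w.2, on_line w gj xi
    & forall d : nat, (forall n, (0 < n)%N -> w *+ n \in xi -> (d %| n)%N) -> d = 1%N].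
Proof.
move=> ij gixi gjxi pos sp line; pose D := det2 gi gj.
have [] := @spans_dvd _ (- gi.2) gi.1 D sp.
  move=> g gxi; rewrite (_ : _ + _ = det2 gi g); last by rewrite /det2; ring.
  have [->|gj'] := eqVneq g gj; first exact: dvdzz.
  by rewrite det2C (line _ gxi gj') oppr0 dvdz0.
rewrite rpredN => /dvdzP[y yE] /dvdzP[x xE].
have wj : det2 (x, y) gj = 1.
  by apply: (mulIf ij); rewrite mul1r -/D {2}/D /det2 /= xE yE; ring.
have [e eE ey] : exists2 e : int, (e = 1 \/ e = -1) & 0 < e * y.
  have y0 : y != 0 by apply: contraTneq (pos _ gixi) => y0; rewrite yE y0 mul0r.
  by have [y_lt0|y_ge0] := ltP y 0; [exists (-1) | exists 1]; lia.
pose w := (e * x, e * y).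
have wjE : det2 w gj = e.
  by rewrite -[RHS]mulr1 -wj /det2 /=; ring.
have onl (g : int * int) : g \in xi -> g != gj ->
    exists2 n : nat, (0 < n)%N & g = w *+ n.
  move=> gxi gj'; have gi0 := line _ gxi gj'.
  have g1 : g.1 = det2 g gj * x.
    apply: (mulIf ij); rewrite -/D; transitivity (det2 g gj * gi.1 - det2 g gi * gj.1).
      by rewrite /D /det2; ring.
    by rewrite gi0 xE; ring.
  have g2 : g.2 = det2 g gj * y.
    apply: (mulIf ij); rewrite -/D; transitivity (det2 g gj * gi.2 - det2 g gi * gj.2).
      by rewrite /D /det2; ring.
    by rewrite gi0 yE; ring.
  have := pos _ gxi => gpos.
  have c0 : 0 < e * det2 g gj by case: eE ey => -> ?; nia.
  exists (absz (e * det2 g gj)); first by lia.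
  by apply: int_pair_eq; rewrite ?pairMn_fst ?pairMn_snd gtz0_abs // ?g1 ?g2 /=;
    case: eE => ->; ring.
exists w; split=> //.
- by rewrite wjE; case: eE => ->.
- split; first exact: gjxi.
  by move=> g gxi; have [->|gj'] := eqVneq g gj; [left | right; exact: onl].
- move=> d dvd; have [|d2 d1] := @spans_dvd _ gj.2 (- gj.1) d%:Z sp.
    move=> g gxi; rewrite (_ : _ + _ = det2 g gj); last by rewrite /det2; ring.
    have [->|gj'] := eqVneq g gj.
      by rewrite (_ : det2 gj gj = 0) ?dvdz0 //; rewrite /det2; ring.
    have [n n0 gE] := onl _ gxi gj'; rewrite gE det2Mn dvdz_mull //.
    by apply: dvd; rewrite -?gE.
  suff : (d%:Z %| det2 (x, y) gj)%Z by rewrite wj dvdz1; lia.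
  rewrite /det2 /=; apply: rpredB; apply: dvdz_mull; first exact: d2.
  by rewrite -rpredN.
Qed.

(** * Sign constraints on the chosen pair *)

Section AxisStep.
Variables (xi : {fset int * int}) (gi gj g0 : int * int).
Implicit Types g h : int * int.
Hypotheses (good : good_pair xi gi gj) (up : upper xi) (pointed : axis_pointed xi).
Hypotheses (g0xi : g0 \in xi) (g0axis : g0.2 = 0).

Let gixi : gi \in xi. Proof. by case: good => -[]. Qed.
Let gi2 : gi.2 = 0. Proof. exact: (axis_gi good up g0xi g0axis). Qed.
Let pointed' : axis_pointed (step xi gi gj). Proof. by case: good. Qed.

Definition on_axis (eta : {fset int * int}) (n : nat) :=
  exists2 g : int * int, g \in eta & g.2 = 0 /\ `|g.1|%N = n.

(** Both [h - gi] and [gi] are on level 0 of the new set, which is pointed as well. Thus the convex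
    hull condition, not [L], makes [gi] the level 0 element nearest to the origin. *)
Lemma axis_step_on_sign h : h \in xi -> h != gi -> h.2 = 0 ->
  0 < (h.1 - gi.1) * gi.1.
Proof.
move=> hxi hi h2; apply: (pointed' (g := h - gi)) => //; last by rewrite /= h2 gi2.
- exact: (axis_step_on good up pointed g0xi g0axis).
- exact: mem_step_l.
Qed.

(** The same condition makes [gj] the extreme element of its level, opposite to the direction of
    [gi]. *)
Lemma axis_step_off_sign h : h \in xi -> h != gj -> h.2 = gj.2 ->
  0 < (h.1 - gj.1) * gi.1.
Proof.
move=> hxi hj h2; have j0 := axis_gj_gt0 good up g0xi g0axis.
apply: (pointed' (g := h - gj)) => //; last by rewrite /= h2 subrr.
- by apply: (axis_step_off good up g0xi g0axis) => //; rewrite h2.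
- exact: mem_step_l.
Qed.

Lemma on_axis_step : exists p, [/\ (0 < p)%N, on_axis xi p, on_axis (step xi gi gj) p
  & forall n, on_axis xi n ->
      n = p \/ (p < n)%N /\ on_axis (step xi gi gj) (n - p)%N].
Proof.
have i0 := axis_gi_neq0 good up g0xi g0axis.
exists `|gi.1|%N; split=> [|||n [h hxi [h2 <-]]]; first by lia.
- by exists gi.
- by exists gi => //; exact: mem_step_l.
have [->|hi] := eqVneq h gi; [by left | right].
have := axis_step_on_sign hxi hi h2; have := pointed hxi gixi h2 gi2 => hg hgi.
have lt : (`|gi.1| < `|h.1|)%N by nia.
split=> //; exists (h - gi).
  exact: (axis_step_on good up pointed g0xi g0axis).
by split; rewrite /= ?h2 ?gi2 //; nia.
Qed.

Lemma unit_gi : `|g0.1| = 1 -> gi = g0.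
Proof.
move=> g01; apply/eqP; rewrite eq_sym; apply: contraT => gi0.
have := axis_step_on_sign g0xi gi0 g0axis.
have := pointed g0xi gixi g0axis gi2.
have : g0.1 = 1 \/ g0.1 = -1 by lia.
by case=> ->; nia.
Qed.

Lemma level1_gj h : h \in xi -> h.2 = 1 -> gj.2 = 1.
Proof.
move=> hxi h2; have := axis_gj_gt0 good up g0xi g0axis.
by have := axis_gj_min good up g0xi g0axis hxi; lia.
Qed.

End AxisStep.

(** * The endgame *)

(* With [gi = (s, 0)], [s = 1 \/ s = -1], and [gj = (a, 1)], the elements with
   [excess s a g <= 0] are exactly those of the semigroup of [gi] and [gj]. *)
Definition excess (s a : int) (g : int * int) : int := s * (a * g.2 - g.1).

Definition excess_chain (m s a : int) (xi : {fset int * int}) :=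
  forall g : int * int, g \in xi -> m < g.2 -> 0 < excess s a g ->
  exists2 h : int * int, h \in xi &
    [/\ h.2 = g.2 - 1, 0 < excess s a h & excess s a g - 1 <= excess s a h].

(** Subtracting [(s, 0)] raises the excess by 1 on the same level; subtracting [(a, 1)] keeps it,
    one level lower. Passing from [a] to [b] lowers it by [s * (a - b)] per level, hence less on
    lower levels. *)
Lemma excess_chain_step (xi : {fset int * int}) (s a b m : int) :
  s = 1 \/ s = -1 -> 0 <= s * (a - b) -> 1 <= m ->
  excess_chain m s a xi ->
  excess_chain (m - 1) s b (step xi (s, 0) (a, 1)).
Proof.
move=> s1 ab m1 chain g gst mg excg.
have ss : s * s = 1 by case: s1 => ->.
have excE g' : excess s b g' = excess s a g' - s * (a - b) * g'.2.
  by rewrite /excess; ring.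
(* This [h] is the element that [(s, 0)] shifts to [g], or the chain successor of the one that
   [(a, 1)] shifts to [g]. *)
have [h hxi [h2 h0 gh]] : exists2 h : int * int, h \in xi &
    [/\ h.2 = g.2, 0 < excess s a h & excess s a g - 1 <= excess s a h].
  have : 0 < excess s a g.
    have dg : 0 <= s * (a - b) * g.2 by apply: mulr_ge0 => //; lia.
    by have := excE g; lia.
  move: g gst mg {excg}; apply: step_ind => [||h hxi _ _ hd|h hxi _ _ _].
  - by rewrite /excess /=; lia.
  - by rewrite /excess /= mulr1 subrr mulr0.
  - have eE : excess s a (h - (s, 0)) = excess s a h + 1.
      by rewrite /excess /= -ss; ring.
    (* Excess 0 means parallel to [(a, 1)], and such elements are not shifted by [(s, 0)]. *)
    have e0 : excess s a h != 0.
      apply: contraNneq hd => e0; rewrite /det2 /= mulr1.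
      suff : s * excess s a h = a * h.2 - h.1 by rewrite e0 mulr0; lia.
      by rewrite /excess mulrA ss mul1r.
    by rewrite eE => mh h0; exists h => //; split=> /=; lia.
  - rewrite (_ : excess s a (h - (a, 1)) = excess s a h); last first.
      by rewrite /excess /=; ring.
    move=> mh h0; have [||k kxi [k2 k0 hk]] := chain h hxi => //.
      by move: mh => /=; lia.
    by exists k.
have excgj : excess s a (h - (a, 1)) = excess s a h by rewrite /excess /=; ring.
exists (h - (a, 1)).
  apply: mem_step_subr => //.
  - by apply: contraTneq h0 => ->; rewrite /excess /=; lia.
  - by apply: contraTneq h0 => ->; rewrite /excess /= mulr1 subrr mulr0.
  - rewrite /det2 /= mulr0 sub0r oppr_eq0 mulf_neq0 //; first by lia.
    by case: s1 => ->.
have h2' : (h - (a, 1)).2 = g.2 - 1 by rewrite /= h2.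
move: excg; rewrite !excE excgj h2'; set D := s * (a - b).
have -> : D * (g.2 - 1) = D * g.2 - D by ring.
move=> excg; split=> //; last by lia.
(* Being one level lower gains [D]: a positive [D] absorbs the loss of 1, and for [D = 0] the
   positive old excess of [h] remains. *)
have [D0|D0] := eqVneq D 0; first by rewrite D0 mul0r; lia.
by lia.
Qed.

(** A positive excess would descend along the chain to level 1, where there is none; on level 0
    pointedness makes the excess negative. Then [g] is [- excess s a g] copies of [(s, 0)] plus
    [g.2] copies of [(a, 1)]. *)
Lemma excess_chain_two_generated (xi : {fset int * int}) (s a : int) :
  s = 1 \/ s = -1 -> upper xi -> axis_pointed xi ->
  (s, 0) \in xi -> (a, 1) \in xi ->
  (forall g : int * int, g \in xi -> g.2 = 1 -> excess s a g <= 0) ->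
  excess_chain 1 s a xi -> two_generated xi.
Proof.
move=> s1 up pointed sxi axi exc1 chain.
have exc0 (g : int * int) : g \in xi -> excess s a g <= 0.
  have [n] : exists n : nat, g.2 = n%:Z \/ g \notin xi.
    have [gxi|gxi] := boolP (g \in xi); last by exists 0%N; right.
    by exists `|g.2|%N; left; have := up _ gxi; lia.
  move=> [gn gxi|/negP//]; elim/ltn_ind: n g gn gxi => n IHn g gn gxi.
  have [n1|n1] := leqP n 1.
    have [g1|g1] := eqVneq g.2 1; first exact: exc1.
    have g0 : g.2 = 0 by lia.
    have := pointed _ _ gxi sxi g0 erefl.
    by rewrite /excess g0 mulr0 sub0r mulrN mulrC /=; lia.
  rewrite leNgt; apply/negP => g0.
  have [|h hxi [h2 h0 _]] := chain g gxi _ g0; first by lia.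
  by have := IHn n.-1 _ h; rewrite h2 gn; lia.
apply: (two_generated_pair sxi axi) => g gxi.
exists `|excess s a g|%N, `|g.2|%N; have := up _ gxi; have := exc0 _ gxi => e0 g0.
have ss : s * s = 1 by case: s1 => ->.
apply: int_pair_eq; rewrite /= ?pairMn_fst ?pairMn_snd /=.
  rewrite !abszE ler0_norm // ger0_norm //.
  suff : s * excess s a g = a * g.2 - g.1 by lia.
  by rewrite /excess mulrA ss mul1r.
by rewrite mul0r add0r mul1r; lia.
Qed.

(** * Whole runs *)

Section Run.
Variables (xs : nat -> {fset int * int}) (u v B : nat).
Hypothesis B_large : (2 * u + 2 ^ u.-1 * v <= B)%N.
Hypotheses (up0 : upper (xs 0)) (pointed0 : axis_pointed (xs 0)).
Hypothesis level0 : forall g : int * int, g \in xs 0 -> g.2 <= u%:Z.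
Hypothesis abscissa0 : forall g : int * int, g \in xs 0 -> `|g.1| <= v%:Z.
Hypothesis spans0 : spans (fun g : int * int => g \in xs 0).
Hypothesis unfinished : forall k, (k <= B)%N -> ~ two_generated (xs k).
Hypothesis steps : forall k, (k <= B)%N ->
  exists gi gj, good_pair (xs k) gi gj /\ xs k.+1 = step (xs k) gi gj.

Lemma run_invariant k : (k <= B.+1)%N ->
  [/\ upper (xs k), axis_pointed (xs k),
      forall g : int * int, g \in xs k -> g.2 <= u%:Z,
      forall g : int * int, g \in xs k -> `|g.1| <= (2 ^ k * v)%N%:Z
    & spans (fun g : int * int => g \in xs k)].
Proof.
elim: k => [|k IHk] kB; first by rewrite mul1n.
have [up pt lev absc sp] := IHk (ltnW kB).
have [gi [gj [good ->]]] := steps kB; split.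
- exact: (step_upper good up).
- by case: good.
- exact: (step_level_le good up lev).
- move=> g /(step_abscissa_le good absc); rewrite expnS; lia.
- exact: (step_spans good pt sp).
Qed.

Lemma u_gt0 : (0 < u)%N.
Proof.
rewrite lt0n; apply/eqP => u0; have [|_] := @spans_dvd _ 0 1 0 spans0; last by [].
move=> g gxs; rewrite mul0r add0r mul1r dvd0z.
by have := level0 gxs; have := up0 gxs; rewrite u0; lia.
Qed.

(** Euclid on the multipliers brings in [w] itself within [M./2] steps, and then [w] and [h]
    generate. *)
Lemma on_line_stops (w h : int * int) t M : (t + M./2 <= B)%N ->
  det2 w h != 0 -> 0 < w.2 -> on_line w h (xs t) ->
  (forall d : nat, (forall n, (0 < n)%N -> w *+ n \in xs t -> (n <= M)%N ->
     (d %| n)%N) -> d = 1%N) ->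
  False.
Proof.
move=> tB wh w2 line gcd1.
have line_t k : (t <= k)%N -> (k <= B)%N -> on_line w h (xs k).
  elim: k => [|k IHk]; first by rewrite leqn0 => /eqP <-.
  rewrite leq_eqVlt => /orP[/eqP <- //|tk kB].
  have [gi [gj [good ->]]] := steps (ltnW kB).
  by case: (on_line_step wh w2 good (IHk tk (ltnW kB))).
have [k tk|d dvd|k kM [_ wxs]] :=
    @subtractive_euclid (fun k n => (0 < n)%N /\ w *+ n \in xs k) M t.
- have kB : (k <= B)%N by lia.
  have [gi [gj [good stepE]]] := steps kB.
  have [_ [p [p0 pxs pxs' sub]]] := on_line_step wh w2 good (line_t k ltac:(lia) kB).
  exists p; rewrite stepE; split=> // n [n0 /(sub n n0)[->|[pn nxs]]]; [by left | right].
  by split=> //; split=> //; rewrite subn_gt0.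
- by apply: gcd1 => n n0 nxs; apply: dvd.
- have tkB : (t + k <= B)%N by lia.
  apply: (unfinished tkB); apply: (on_line_two_generated (line_t _ _ tkB)) => //.
  exact: leq_addr.
Qed.

(** The off-axis steps need [m] to bound the whole set; once level 0 is occupied, a spanning part
    below [m] suffices. *)
Definition descending (t : nat) (m : int) :=
  spans (fun g : int * int => g \in xs t /\ g.2 <= m) /\
  ((exists2 g : int * int, g \in xs t & g.2 = 0) \/
   forall g : int * int, g \in xs t -> g.2 <= m).

Lemma descending_step t (m : nat) : (t + m = u)%N -> (0 < m)%N ->
  descending t m ->
  if m == 1%N then reaches_one (xs t.+1) else descending t.+1 (m%:Z - 1).
Proof.
move=> tm m0 [sp lev]; have tB : (t <= B)%N by lia.
have [up pt _ _ spt] := run_invariant (leqW tB).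
have [gi [gj [good stepE]]] := steps tB.
have [gixi gjxi] : gi \in xs t /\ gj \in xs t by case: good.
have [[g0 g0xi g02]|noaxis] := pselect (exists2 g : int * int, g \in xs t & g.2 = 0).
  rewrite stepE; case: eqP => [m1|m1].
    by apply: (axis_step_last good up pt g0xi g02); rewrite m1 in sp.
  rewrite /descending stepE; split.
    by apply: (axis_step_drop good up pt g0xi g02) => //; lia.
  by left; exists gi; [exact: mem_step_l | exact: (axis_gi good up g0xi g02)].
have pos (g : int * int) : g \in xs t -> 0 < g.2.
  move=> gxi; rewrite lt_def up // andbT; apply/eqP => g2; apply: noaxis.
  by exists g.
have {lev}lev (g : int * int) : g \in xs t -> g.2 <= m%:Z.
  by case: lev => [/noaxis[]|]; apply.
have [jm|] := ltP gj.2 m%:Z.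
  case: eqP => [m1|m1]; first by have := pos _ gjxi; lia.
  have lev' := off_axis_step_drop good pos lev jm.
  rewrite /descending stepE; split; last by right.
  apply: spans_trans (step_spans good pt spt) _ => H _ stepH g gst.
  by apply: stepH; split=> //; exact: lev'.
move=> mj; have {mj}jm : gj.2 = m by have := lev _ gjxi; lia.
(* Now everything independent of [gi] has level [m]: either there is a second such element, or all
   but [gj] lie on the line of [gi]. *)
have [[w wxi [wj wd]]|noline] :=
    pselect (exists2 w : int * int, w \in xs t & w != gj /\ det2 w gi != 0).
  case: eqP => [m1|m1].
    by rewrite stepE; apply: (top_step_last good pt pos lev jm wxi wj wd) => //; rewrite m1.
  rewrite /descending stepE; split.
    by apply: (top_step_drop good pt pos lev jm wxi wj wd) => //; lia.
  left; exists (w - gj); first exact: (top_sub_gj wxi wj wd).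
  exact: (top_axis good lev jm wxi wj wd).
have ij : det2 gi gj != 0 by case: good.
have [|w [wj w2 line gcd1]] := line_generator ij gixi gjxi pos spt.
  move=> g gxi gj'; apply/eqP; apply: contraT => gd; case: noline.
  by exists g.
exfalso; apply: (@on_line_stops w gj t m) => //; first by lia.
  by apply: contra_eqN wj => /eqP ->.
move=> d dvd; apply: gcd1 => n n0 nxi; apply: dvd => //.
have := lev _ nxi; rewrite pairMn_snd; nia.
Qed.

Lemma run_reaches_one : reaches_one (xs u).
Proof.
have desc t : (t < u)%N -> descending t (u - t)%N%:Z.
  elim: t => [|t IHt] tu.
    rewrite subn0; split; last by right.
    apply: spans_trans spans0 _ => H _ HxsH g gxs.
    by apply: HxsH; split=> //; exact: level0.
  have := @descending_step t (u - t) ltac:(lia) ltac:(lia) (IHt (ltnW tu)).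
  case: eqP => [|_]; first by lia.
  by rewrite (_ : (u - t)%N%:Z - 1 = (u - t.+1)%N%:Z) //; lia.
have u0 := u_gt0.
have := @descending_step u.-1 1 ltac:(lia) isT; rewrite eqxx (ltn_predK u0); apply.
by have := desc u.-1 ltac:(lia); rewrite (_ : (u - u.-1)%N = 1%N) //; lia.
Qed.

Lemma run_axis k : (u <= k)%N -> (k <= B.+1)%N ->
  (exists2 g : int * int, g \in xs k & g.2 = 0) /\
  (exists2 g : int * int, g \in xs k & g.2 = 1).
Proof.
elim: k => [|k IHk]; first by rewrite leqNgt u_gt0.
have step_case : (u <= k)%N -> (k < B.+1)%N ->
    (exists2 g : int * int, g \in xs k.+1 & g.2 = 0) /\
    (exists2 g : int * int, g \in xs k.+1 & g.2 = 1).
  move=> uk kB; have [[g0 g0xs g02] [g1 g1xs g12]] := IHk uk (ltnW kB).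
  have [up _ _ _ _] := run_invariant (ltnW kB).
  have [gi [gj [good ->]]] := steps kB; split.
    by exists gi; [exact: mem_step_l | exact: (axis_gi good up g0xs g02)].
  by exists gj; [exact: mem_step_r | exact: (level1_gj good up g0xs g02 g1xs g12)].
rewrite leq_eqVlt => /orP[/eqP uk kB|]; last exact: step_case.
have [one gcd1] := run_reaches_one; rewrite -uk; split=> //.
apply: contrapT => noaxis; suff : (0 %| 1)%Z by [].
by apply: gcd1 => g gxs g2; case: noaxis; exists g.
Qed.

(** After [u] steps the abscissae are at most [2 ^ u * v]; Euclid takes half of that, whence the
    exponent [u.-1]. *)
Lemma run_unit : exists2 k, (u <= k <= u + 2 ^ u.-1 * v)%N & on_axis (xs k) 1%N.
Proof.
have u0 := u_gt0.
have half : (2 ^ u * v)./2 = (2 ^ u.-1 * v)%N.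
  by rewrite -{1}(ltn_predK u0) expnS -mulnA mul2n doubleK.
have [k|d dvd|k kM one] := @subtractive_euclid (fun k => on_axis (xs k)) (2 ^ u * v) u.
- rewrite half => kB; have {}kB : (k <= B)%N /\ (u <= k)%N by lia.
  have [up pt _ _ _] := run_invariant (leqW kB.1).
  have [[g0 g0xs g02] _] := run_axis kB.2 (leqW kB.1).
  have [gi [gj [good ->]]] := steps kB.1.
  exact: (on_axis_step good up pt g0xs g02).
- have [_ gcd1] := run_reaches_one; suff : (d%:Z %| 1)%Z by rewrite dvdz1; lia.
  have [_ _ _ absc _] := @run_invariant u ltac:(lia).
  apply: gcd1 => g gxs g2; apply: (dvd `|g.1|%N); first by exists g.
  by have := absc g gxs; lia.
- by exists (u + k)%N => //; move: kM; rewrite half; lia.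
Qed.

Lemma run_contradiction : False.
Proof.
have u0 := u_gt0; have [t tu [[s s2] sxs /= [s20 s1]]] := run_unit.
rewrite {s2}s20 in sxs.
have {}s1 : s = 1 \/ s = -1 by lia.
have pair_at k : (t <= k)%N -> (k <= B)%N -> (s, 0) \in xs k ->
    exists a, good_pair (xs k) (s, 0) (a, 1) /\ xs k.+1 = step (xs k) (s, 0) (a, 1).
  move=> tk kB sxk; have [up pt _ _ _] := run_invariant (leqW kB).
  have [_ [g1 g1xs g12]] := @run_axis k ltac:(lia) (leqW kB).
  have [gi [gj [good stepE]]] := steps kB.
  have giE := unit_gi good up pt sxk erefl ltac:(rewrite /=; lia).
  have gj2 := level1_gj good up sxk erefl g1xs g12.
  exists gj.1; rewrite (_ : (gj.1, 1) = gj); last exact: int_pair_eq.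
  by rewrite -giE.
(* For [j = 0] no level exceeds [u], so the chain property is vacuous. The last index [t + u.-1] is
   still within [B]. *)
have chain j : (j < u)%N -> (s, 0) \in xs (t + j)%N /\ exists a,
    [/\ good_pair (xs (t + j)%N) (s, 0) (a, 1),
        xs (t + j).+1 = step (xs (t + j)%N) (s, 0) (a, 1)
      & excess_chain (u - j)%N s a (xs (t + j)%N)].
  elim: j => [|j IHj] ju.
    rewrite addn0; split=> //; have tB : (t <= B)%N by lia.
    have [a [good stepE]] := pair_at t (leqnn t) tB sxs.
    exists a; split=> // g gxs; have [_ _ lev _ _] := run_invariant (leqW tB).
    by have := lev g gxs; lia.
  have [sxj [a [good stepE chain]]] := IHj (ltnW ju).
  have sxj' : (s, 0) \in xs (t + j.+1)%N by rewrite addnS stepE mem_step_l.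
  split=> //; have jB : (t + j.+1 <= B)%N by lia.
  have [b [good' stepE']] := pair_at _ (leq_addr _ _) jB sxj'.
  exists b; split=> //; rewrite addnS stepE.
  rewrite (_ : (u - j.+1)%N%:Z = (u - j)%N%:Z - 1); last by lia.
  apply: excess_chain_step => //; last by lia.
  have [->|ab] := eqVneq a b; first by rewrite subrr mulr0.
  have [up _ _ _ _] := run_invariant (leqW jB).
  have axj : (a, 1) \in xs (t + j.+1)%N by rewrite addnS stepE mem_step_r.
  (* The step kept [(a, 1)], so extremality of the new [(b, 1)] on level 1 gives the sign of
     [a - b]. *)
  rewrite mulrC ltW //.
  apply: (axis_step_off_sign good' up sxj' erefl axj) => //.
  by apply: contraNneq ab => -[->].
have [sxk [a [good stepE chain1]]] := chain u.-1 ltac:(lia).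
have kB : (t + u.-1 <= B)%N by lia.
have [up pt _ _ _] := run_invariant (leqW kB).
have axk : (a, 1) \in xs (t + u.-1)%N by case: good => -[].
apply: (unfinished kB); apply: (excess_chain_two_generated s1 up pt sxk axk).
- move=> g gxs g2; have [->|ga] := eqVneq g (a, 1).
    by rewrite /excess mulr1 subrr mulr0.
  have := axis_step_off_sign good up sxk erefl gxs ga g2.
  by rewrite /excess g2 mulr1 /=; lia.
- by move: chain1; rewrite (_ : (u - u.-1)%N = 1%N) //; lia.
Qed.

End Run.

Theorem theorem4p8 (R : realType) (xi : {fset int * int})
    (hpos : forall g : int * int, g \in xi -> 0 <= Ly g)
    (hxi : toric_exponents xi)
    (hconv : ~ Conv xi ((0, 0) : R * R))
    (xs : nat -> {fset int * int}) (hxs : run R Ly xi xs) :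
  exists k : nat,
    (k <= 2 * u0 Ly xi + 2 ^ (u0 Ly xi).-1 * v0 xi)%N /\ two_generated (xs k).
Proof.
(* A run must step as long as it is unfinished, so failure up to the bound provides all the steps
   that [run_contradiction] asks for. *)
case: hxs => xs0 hxs; apply: contrapT => never.
have unfinished k : (k <= 2 * u0 Ly xi + 2 ^ (u0 Ly xi).-1 * v0 xi)%N ->
    ~ two_generated (xs k).
  by move=> kB gen; apply: never; exists k.
apply: (run_contradiction (leqnn _) _ _ _ _ _ unfinished); rewrite ?xs0.
- exact: hpos.
- exact: Conv_axis_pointed hconv.
- move=> g gxi; have := hpos g gxi.
  have : (`|Ly g| <= u0 Ly xi)%N by rewrite /u0 (leq_bigmax_seq _ gxi).
  by rewrite /Ly; lia.
- move=> g gxi.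
  have : (`|g.1| <= v0 xi)%N by rewrite /v0 (leq_bigmax_seq _ gxi).
  by lia.
- exact: toric_spans.
- move=> k /unfinished /hxs[gi [gj [[mem ij mini minj n0] stepE]]].
  exists gi, gj; split=> //; split=> //.
  exact: Conv_axis_pointed n0.
Qed.
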